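(* Let $P^\star=H^\star\cup\overline{H^\star}$, where $H^\star$ is the explicit set of $287$ binary words listed in the context and $\overline{H^\star}$ is the set of bitwise complements of words in $H^\star$. Then $|P^\star|=574$, and the numbers $p_\ell$ of words of length $\ell$ in $P^\star$ are $$(p_{10},\dots,p_{19})=(14,6,78,58,56,92,60,72,58,80),\qquad p_\ell=0\text{ otherwise.}$$ For every $n\ge0$ the code $C_n(P^\star)=(P^\star)^*\cap\{0,1\}^n$ is correcting, i.e. $B(c)\cap B(c')=\emptyset$ for all distinct $c,c'\in C_n(P^\star)$. Moreover, if $\lambda^\star$ is the unique positive solution of $\sum_{\ell=10}^{19}p_\ell(\lambda^\star)^{-\ell}=1$, then $|C_n(P^\star)|=(\lambda^\star)^{n+o(n)}$ along the lengths $n\to\infty$ with $C_n(P^\star)\neq\emptyset$, so the asymptotic rate of the family is $\log_2\lambda^\star$, and $\log_2\lambda^\star\approx0.653618$ (with error less than $10^{-6}$).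
   Context: For $c\in\{0,1\}^n$, the radius-one ball $B(c)$ is the set of all words $z=z_1\cdots z_n$ with $z_i=c_{\pi(i)}$ for some permutation $\pi$ of $\{1,\dots,n\}$ satisfying $|\pi(i)-i|\le 1$ for all $i$; equivalently, all words obtained from $c$ by swapping the symbols in any set of pairwise disjoint pairs of adjacent positions. For a set $P$ of nonempty binary words, $P^*$ is the set of all finite concatenations (including the empty one) of words in $P$. The bitwise complement of $w_1\cdots w_n$ is $(1-w_1)\cdots(1-w_n)$. The set $H^\star$ consists of the following words. Length 10: 0000111111, 0001000000, 0001111000, 0111000000, 0111110000, 0111111000, 0111111111. Length 11: 00001111000, 00010000111, 00011101111. Length 12: 000000000000, 000000000111, 000000001111, 000000110000, 000000111000, 000000111111, 000001110000, 000001111000, 000001111111, 000011101111, 000100010000, 000110000000, 000110000111, 000110001111, 000111000000, 000111000111, 000111110000, 000111111000, 000111111111, 001100011111, 001110000000, 001110000111, 001110001111, 001111000000, 001111000111, 001111001111, 001111110000, 001111111000, 001111111111, 011100001111, 011100010000, 011101110000, 011101111000, 011101111111, 011110000000, 011110000111, 011110001111, 011110011111, 011111110000. Length 13: 0000000000111, 0000000111000, 0000000111111, 0000001000000, 0000001111000, 0000011111000, 0000110000111, 0000111000000, 0000111000111, 0000111110000, 0001000001111, 0001000111111, 0001110000111, 0001111001111, 0001111111000, 0011000000111, 0011100000111, 0011110000111, 0011110111000, 0011110111111, 0011111000000, 0011111000111, 0011111111000, 0111000001111, 0111000111111, 0111100000111, 0111110001111, 0111111001111, 0111111110000. Length 14: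 00000001111000, 00000010000111, 00001110000111, 00001111001111, 00010000110000, 00010001111000, 00011000010000, 00011100010000, 00011101110000, 00110000110000, 00110001110000, 00110001111000, 00111001110000, 00111100010000, 00111101111000, 00111110000111, 01110000110000, 01110000111000, 01110001111000, 01110111101111, 01111000010000, 01111000110000, 01111000111000, 01111001110000, 01111001111000, 01111101110000, 01111110111000, 01111110111111. Length 15: 000000000001111, 000000000110000, 000000001110000, 000000011101111, 000000011111000, 000000100000111, 000000100010000, 000000110001111, 000000111001111, 000000111110000, 000001110001111, 000001111001111, 000001111110000, 000011100010000, 000011101110000, 000100000111000, 000100010001111, 000100011101111, 000100011111000, 000110000001111, 000110001110000, 000111000001111, 000111110001111, 000111111001111, 000111111110000, 001110000001111, 001110000110000, 001110001110000, 001111000001111, 001111001110000, 001111011101111, 001111011111000, 001111100010000, 001111110001111, 001111111001111, 001111111110000, 011100000111000, 011100010001111, 011100011101111, 011100011111000, 011101110001111, 011101111110000, 011110000001111, 011111000111000, 011111101111000, 011111110001111. Length 16: 0000000001000000, 0000000001000111, 0000001000111000, 0000001000111111, 0000001110111000, 0000001110111111, 0000011110111000, 0000011110111111, 0000110000110000, 0000111000001111, 0000111110001111, 0001000111000000, 0001000111000111, 0001110000110000, 0001111001110000, 0001111110111000, 0001111110111111, 0011100001000000, 0011100001000111, 0011110000110000, 0011111000001111, 0011111110111000, 0011111110111111, 0111000111000000, 0111000111000111, 0111011111001111, 0111100000110000, 0111111001110000, 0111111011101111, 0111111110001111. Length 17: 00000000010000111, 00000000110000111, 00000001111001111, 00000010000110000,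 00000010001111000, 00000011001111000, 00000011101111000, 00000110000111000, 00000111001111000, 00000111101111000, 00001110000110000, 00001111001110000, 00010000110001111, 00010001110000111, 00010001111001111, 00011000010001111, 00011100010001111, 00011101110001111, 00011111101111000, 00110000111000111, 00111000010000111, 00111000110000111, 00111001111000111, 00111100010001111, 00111101111001111, 00111110000110000, 00111111001111000, 00111111101111000, 01110000110001111, 01110001110000111, 01110001111001111, 01110111101110000, 01111000010001111, 01111001110001111, 01111101110001111, 01111110111110000. Length 18: 000000000001110000, 000000000100010000, 000000001110001111, 000000100011101111, 000000111011101111, 000000111110001111, 000001110001110000, 000001111011101111, 000001111110001111, 000011100010001111, 000011101110001111, 000100011100010000, 000110000001110000, 000111000001110000, 000111110001110000, 000111111011101111, 000111111110001111, 001110000001110000, 001110000100010000, 001110001110001111, 001111000001110000, 001111100010001111, 001111111011101111, 001111111110001111, 011100011100010000, 011101111110001111, 011110000001110000, 011111101111001111, 011111110001110000. Length 19: 0000000001000001111, 0000000001000011000, 0000001000111100111, 0000001000111110000, 0000001110111100111, 0000001110111110000, 0000011110111100111, 0000011110111110000, 0000110000110001111, 0000111000001110000, 0000111000011000111, 0000111100111000111, 0000111110001110000, 0001000111000001111, 0001000111000011000, 0001100001000111000, 0001110000110001111, 0001110001000111000, 0001110111000111000, 0001111001110001111, 0001111110111100111, 0001111110111110000, 0011100001000001111, 0011100001000011000, 0011110000110001111, 0011110001000111000, 0011111000001110000, 0011111000011000111, 0011111110111100111, 0011111110111110000, 0111000111000001111, 0111000111000011000, 0111011110111000111, 0111011111001110000,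 0111100000110001111, 0111100001000111000, 0111110111000111000, 0111111001110001111, 0111111011101110000, 0111111011111000111. *)

(* Defs.v *)
From Stdlib Require Import String Ascii.
From mathcomp Require Import all_boot all_order all_algebra all_fingroup.
From mathcomp Require Import finmap.
From mathcomp Require Import all_classical all_reals all_analysis.
Import Order.TTheory GRing.Theory Num.Theory.
Import numFieldNormedType.Exports.

Set Implicit Arguments.
Unset Strict Implicit.
Unset Printing Implicit Defensive.

(* Binary words, with [true] standing for the symbol 1 and [false] for 0. *)
Definition word := seq bool.

Definition complement (w : word) : word := map negb w.

Definition star (P : {fset word}) : set word :=
  [set w | exists2 ws : seq word, {subset ws <= P} & w = flatten ws].

Definition star_code (P : {fset word}) (n : nat) : {set n.-tuple bool} :=
  [set c : n.-tuple bool | `[< star P (tval c) >]].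

(* [`|pi i - i|] is the distance between the two positions (as integers). *)
Definition ball1 (n : nat) (c : n.-tuple bool) : {set n.-tuple bool} :=
  [set z : n.-tuple bool | [exists pi : {perm 'I_n},
     [forall i : 'I_n,
        (`|(pi i : nat) - (i : nat)| <= 1)%N && (tnth z i == tnth c (pi i))]]].

Definition correcting (n : nat) (C : {set n.-tuple bool}) : Prop :=
  forall c c' : n.-tuple bool,
    c \in C -> c' \in C -> c != c' -> ball1 c :&: ball1 c' = finset.set0.

Definition num_of_length (P : {fset word}) (l : nat) : nat :=
  #|` [fset w in P | size w == l]%fset|.

(* The lengths for which a family of codes, one for each length, is nonempty. *)
Definition lengths (C : forall n, {set n.-tuple bool}) : set nat :=
  [set n | C n != finset.set0].

Definition log2 (R : realType) (x : R) : R := (ln x / ln 2)%R.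

(* The rate [log2 #|C n| / n] converges to [r] along the infinitely many lengths
   for which [C n] is nonempty. *)
Definition has_asymptotic_rate (R : realType)
    (C : forall n, {set n.-tuple bool}) (r : R) : Prop :=
  infinite_set (lengths C) /\
  ((fun n : nat => log2 #|C n|%:R / n%:R : R)%R @ within (lengths C) \oo
     --> r)%classic.

Fixpoint word_of_string (s : string) : word :=
  match s with
  | EmptyString => [::]
  | String a s' => Ascii.eqb a "1" :: word_of_string s'
  end.

Definition Hstar_list : seq string := [::
  "0000111111"; "0001000000"; "0001111000"; "0111000000"; "0111110000";
  "0111111000"; "0111111111";
  "00001111000"; "00010000111"; "00011101111";
  "000000000000"; "000000000111"; "000000001111"; "000000110000";
  "000000111000"; "000000111111"; "000001110000"; "000001111000";
  "000001111111"; "000011101111"; "000100010000"; "000110000000";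
  "000110000111"; "000110001111"; "000111000000"; "000111000111";
  "000111110000"; "000111111000"; "000111111111"; "001100011111";
  "001110000000"; "001110000111"; "001110001111"; "001111000000";
  "001111000111"; "001111001111"; "001111110000"; "001111111000";
  "001111111111"; "011100001111"; "011100010000"; "011101110000";
  "011101111000"; "011101111111"; "011110000000"; "011110000111";
  "011110001111"; "011110011111"; "011111110000";
  "0000000000111"; "0000000111000"; "0000000111111"; "0000001000000";
  "0000001111000"; "0000011111000"; "0000110000111"; "0000111000000";
  "0000111000111"; "0000111110000"; "0001000001111"; "0001000111111";
  "0001110000111"; "0001111001111"; "0001111111000"; "0011000000111";
  "0011100000111"; "0011110000111"; "0011110111000"; "0011110111111";
  "0011111000000"; "0011111000111"; "0011111111000"; "0111000001111";
  "0111000111111"; "0111100000111"; "0111110001111"; "0111111001111";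
  "0111111110000";
  "00000001111000"; "00000010000111"; "00001110000111"; "00001111001111";
  "00010000110000"; "00010001111000"; "00011000010000"; "00011100010000";
  "00011101110000"; "00110000110000"; "00110001110000"; "00110001111000";
  "00111001110000"; "00111100010000"; "00111101111000"; "00111110000111";
  "01110000110000"; "01110000111000"; "01110001111000"; "01110111101111";
  "01111000010000"; "01111000110000"; "01111000111000"; "01111001110000";
  "01111001111000"; "01111101110000"; "01111110111000"; "01111110111111";
  "000000000001111"; "000000000110000"; "000000001110000"; "000000011101111";
  "000000011111000"; "000000100000111"; "000000100010000"; "000000110001111";
  "000000111001111"; "000000111110000"; "000001110001111"; "000001111001111";
  "000001111110000"; "000011100010000"; "000011101110000"; "000100000111000";
  "000100010001111"; "000100011101111"; "000100011111000"; "000110000001111";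
  "000110001110000"; "000111000001111"; "000111110001111"; "000111111001111";
  "000111111110000"; "001110000001111"; "001110000110000"; "001110001110000";
  "001111000001111"; "001111001110000"; "001111011101111"; "001111011111000";
  "001111100010000"; "001111110001111"; "001111111001111"; "001111111110000";
  "011100000111000"; "011100010001111"; "011100011101111"; "011100011111000";
  "011101110001111"; "011101111110000"; "011110000001111"; "011111000111000";
  "011111101111000"; "011111110001111";
  "0000000001000000"; "0000000001000111"; "0000001000111000";
  "0000001000111111"; "0000001110111000"; "0000001110111111";
  "0000011110111000"; "0000011110111111"; "0000110000110000";
  "0000111000001111"; "0000111110001111"; "0001000111000000";
  "0001000111000111"; "0001110000110000"; "0001111001110000";
  "0001111110111000"; "0001111110111111"; "0011100001000000";
  "0011100001000111"; "0011110000110000"; "0011111000001111";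
  "0011111110111000"; "0011111110111111"; "0111000111000000";
  "0111000111000111"; "0111011111001111"; "0111100000110000";
  "0111111001110000"; "0111111011101111"; "0111111110001111";
  "00000000010000111"; "00000000110000111"; "00000001111001111";
  "00000010000110000"; "00000010001111000"; "00000011001111000";
  "00000011101111000"; "00000110000111000"; "00000111001111000";
  "00000111101111000"; "00001110000110000"; "00001111001110000";
  "00010000110001111"; "00010001110000111"; "00010001111001111";
  "00011000010001111"; "00011100010001111"; "00011101110001111";
  "00011111101111000"; "00110000111000111"; "00111000010000111";
  "00111000110000111"; "00111001111000111"; "00111100010001111";
  "00111101111001111"; "00111110000110000"; "00111111001111000";
  "00111111101111000"; "01110000110001111"; "01110001110000111";
  "01110001111001111"; "01110111101110000"; "01111000010001111";
  "01111001110001111"; "01111101110001111"; "01111110111110000";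
  "000000000001110000"; "000000000100010000"; "000000001110001111";
  "000000100011101111"; "000000111011101111"; "000000111110001111";
  "000001110001110000"; "000001111011101111"; "000001111110001111";
  "000011100010001111"; "000011101110001111"; "000100011100010000";
  "000110000001110000"; "000111000001110000"; "000111110001110000";
  "000111111011101111"; "000111111110001111"; "001110000001110000";
  "001110000100010000"; "001110001110001111"; "001111000001110000";
  "001111100010001111"; "001111111011101111"; "001111111110001111";
  "011100011100010000"; "011101111110001111"; "011110000001110000";
  "011111101111001111"; "011111110001110000";
  "0000000001000001111"; "0000000001000011000"; "0000001000111100111";
  "0000001000111110000"; "0000001110111100111"; "0000001110111110000";
  "0000011110111100111"; "0000011110111110000"; "0000110000110001111";
  "0000111000001110000"; "0000111000011000111"; "0000111100111000111";
  "0000111110001110000"; "0001000111000001111"; "0001000111000011000";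
  "0001100001000111000"; "0001110000110001111"; "0001110001000111000";
  "0001110111000111000"; "0001111001110001111"; "0001111110111100111";
  "0001111110111110000"; "0011100001000001111"; "0011100001000011000";
  "0011110000110001111"; "0011110001000111000"; "0011111000001110000";
  "0011111000011000111"; "0011111110111100111"; "0011111110111110000";
  "0111000111000001111"; "0111000111000011000"; "0111011110111000111";
  "0111011111001110000"; "0111100000110001111"; "0111100001000111000";
  "0111110111000111000"; "0111111001110001111"; "0111111011101110000";
  "0111111011111000111"
]%string.

Definition Hstar : {fset word} :=
  [fset w in map word_of_string Hstar_list]%fset.

Definition Pstar : {fset word} := (Hstar `|` [fset complement w | w in Hstar])%fset.

(* Main.v *)
(** Two words [c] and [c'] have intersecting balls iff their differing positions
    come in consecutive pairs, of opposite signs, between which the common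
    symbols alternate. A deterministic automaton with finitely many states reads
    [c] and [c'] in parallel and checks this. Running it on two concatenations
    of words of [Pstar], Sardinas-Patterson style, one only has to remember its
    state and the suffix by which one concatenation is ahead of the other. From
    the empty suffix only 24 further configurations are reachable, and in none
    of them are both words exhausted after a difference: hence the code is
    correcting, and [Pstar] is prefix-free.

    Prefix-freeness turns the numbers of codewords into the solution of the
    linear recurrence with coefficients [p_l], which lies between
    [lambda ^ (n - 110)] and [lambda ^ n] for [n >= 90]; all such lengths occur,
    since [Pstar] has words of lengths 10 and 11. *)

From HB Require Import structures.
From Stdlib Require Import String NArith.
Require Import Defs.
From mathcomp Require Import all_boot all_order all_algebra all_fingroup.
From mathcomp Require Import finmap.
From mathcomp Require Import all_classical all_reals all_analysis.
From mathcomp Require Import zify ring lra.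
Import Order.TTheory GRing.Theory Num.Theory.
Import numFieldNormedType.Exports.

Set Implicit Arguments.
Unset Strict Implicit.

(** * Intersecting balls *)

(** The ball as disjoint adjacent swaps read from the left, so that two words sharing [z] can be
    compared symbol by symbol. Swapping equal symbols is allowed and agrees with two keeps. *)
Inductive swaps : word -> word -> Prop :=
| swaps_nil : swaps [::] [::]
| swaps_keep a c z : swaps c z -> swaps (a :: c) (a :: z)
| swaps_swap a b c z : swaps c z -> swaps [:: a, b & c] [:: b, a & z].

Arguments swaps_keep a {c z} _.

(** Either [f] fixes 0 or it exchanges 0 and 1; removing these positions leaves a map of the same
    kind. A function on [nat] in place of a permutation makes this shift easy to state. *)
Lemma swaps_of_displacement (f : nat -> nat) (c z : word) :
  size z = size c ->
  (forall i, (i < size c)%N -> (f i < size c)%N /\ (f i <= i.+1)%N /\ (i <= (f i).+1)%N) ->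
  (forall i j, (i < size c)%N -> (j < size c)%N -> f i = f j -> i = j) ->
  (forall j, (j < size c)%N -> exists2 i, (i < size c)%N & f i = j) ->
  (forall i, (i < size c)%N -> nth false z i = nth false c (f i)) ->
  swaps c z.
Proof.
have [m] := ubnP (size c); elim: m f c z => // m IH f c z + szz.
case: c z szz => [|a c] [|x z] //=; first by move=> *; exact: swaps_nil.
move=> [szz] szc fle finj fsurj zE.
have [_ [f0 _]] := fle 0 isT.
have [f00|f0n] := eqVneq (f 0) 0%N.
  have := zE 0 isT; rewrite /= f00 /= => ->.
  have fS i : (i < size c)%N -> (0 < f i.+1)%N.
    move=> ic; rewrite lt0n; apply/eqP => fi0.
    by have := finj i.+1 0 ic isT; rewrite fi0 f00 => /(_ erefl).
  apply/swaps_keep/(IH (fun i => (f i.+1).-1)) => //.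
  - move=> i ic; have := fle i.+1 ic; have := fS i ic; move: ic => /=; lia.
  - move=> i j ic jc E; apply/succn_inj/finj => //.
    by have := fS i ic; have := fS j jc; move: E; lia.
  - move=> j jc; have [[|i] ic fi] := fsurj j.+1 jc; first by lia.
    by exists i => //; rewrite fi.
  - move=> i ic; have /= -> := zE i.+1 ic; have := fS i ic.
    by case: (f i.+1).
have f01 : f 0 = 1%N by lia.
(* The preimage of 0 is at most 1, and it is not 0 because [f 0 = 1]. *)
have f10 : f 1 = 0%N.
  have [i ic fi0] := fsurj 0 isT; have := fle i ic.
  case: i fi0 ic => [|[|i]]; [lia|by []|lia].
case: c z szz szc fle finj fsurj zE => [|b c] [|y z] // szz szc fle finj fsurj zE.
  by have := fle 0 isT; rewrite f01 /=; lia.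
have := zE 0 isT; have := zE 1%N isT; rewrite f01 f10 /= => -> ->.
have fS i : (i < size c)%N -> (1 < f i.+2)%N.
  move=> ic; case E : (f i.+2) => [|[|k]] //.
    by have := finj i.+2 1 ic isT; rewrite E f10 => /(_ erefl).
  by have := finj i.+2 0 ic isT; rewrite E f01 => /(_ erefl).
move: szz szc => /= [szz] szc.
apply/swaps_swap/(IH (fun i => (f i.+2).-2)) => //=; first by lia.
- move=> i ic; have := fle i.+2 ic; have := fS i ic => /=; lia.
- move=> i j ic jc E; apply/succn_inj/succn_inj/finj => //.
  by have := fS i ic; have := fS j jc; move: E; lia.
- move=> j jc; have [[|[|i]] ic fi] := fsurj j.+2 jc; [lia|lia|].
  by exists i => //; rewrite fi.
- move=> i ic; have /= -> := zE i.+2 ic; have := fS i ic.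
  by case: (f i.+2) => [|[|]].
Qed.

Lemma swaps_of_ball1 (n : nat) (c z : n.-tuple bool) :
  z \in ball1 c -> swaps c z.
Proof.
rewrite inE => /existsP[pi /forallP piP].
(* [inord] requires an ordinal type of successor size. *)
case: n c z pi piP => [|n] c z pi piP.
  by rewrite (tuple0 c) (tuple0 z); exact: swaps_nil.
pose f i := nat_of_ord (pi (inord i)).
apply: (@swaps_of_displacement f); rewrite !size_tuple //.
- move=> i ilt; have /andP[d _] := piP (inord i).
  by split; [rewrite /f ltn_ord|move: d; rewrite /f inordK //; lia].
- move=> i j ilt jlt /val_inj/perm_inj/(congr1 val) /=.
  by rewrite !inordK.
- move=> j jlt; exists ((pi^-1)%g (inord j)) => //.
  by rewrite /f inord_val permKV inordK.
- move=> i ilt; have /andP[_ /eqP] := piP (inord i).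
  by rewrite !(tnth_nth false) inordK.
Qed.

(* [Same d]: the differences read so far are paired up, and [d] tells whether
   there are any. [Open a l]: the last difference has symbol [a] on the left and
   is unmatched, and [l] is the last common symbol since. *)
Variant state := Same of bool | Open of bool & option bool.

Definition state_code (s : state) : bool + bool * option bool :=
  match s with Same d => inl d | Open a l => inr (a, l) end.

Definition state_decode (x : bool + bool * option bool) : state :=
  match x with inl d => Same d | inr (a, l) => Open a l end.

Lemma state_codeK : cancel state_code state_decode. Proof. by case. Qed.

HB.instance Definition _ := Equality.copy state (can_type state_codeK).

(** Between two paired differences the swaps of the two words are offset by one position; this
    forces the alternation and the opposite closing sign. [None] means that the balls are
    disjoint. *)
Definition step (s : state) (a b : bool) : option state :=
  match s with
  | Same d => Some (if a == b then Same d else Open a None)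
  | Open x l =>
      if a == b then (if l == Some a then None else Some (Open x (Some a)))
      else if a == x then None else Some (Same true)
  end.

(** At least one returned suffix is empty; the other one is the dangling suffix. *)
Fixpoint run (s : state) (c c' : word) : option (state * word * word) :=
  match c, c' with
  | a :: c1, b :: c1' => if step s a b is Some s' then run s' c1 c1' else None
  | _, _ => Some (s, c, c')
  end.

(* In the last two claims the right, respectively left, word is in the middle of
   a swap: its next symbol has already been matched with [z], and the symbol it
   still owes to [z] is put in front of [z] for the other word. *)
Lemma run_swaps_aux (m : nat) (z c c' : word) : (size z < m)%N ->
  (forall d, swaps c z -> swaps c' z ->
     exists d', run (Same d) c c' = Some (Same d', [::], [::])) /\
  (forall a l, l != Some a -> swaps c (~~ a :: z) -> swaps c' z ->
     exists d', run (Open a l) c (a :: c') = Some (Same d', [::], [::])) /\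
  (forall a l, l != Some (~~ a) -> swaps c z -> swaps c' (a :: z) ->
     exists d', run (Open a l) (~~ a :: c) c' = Some (Same d', [::], [::])).
Proof.
elim: m z c c' => // m IH z c c' zm.
(* Isolated because closing a difference in the other two claims leads back to this claim for the
   same [z]. *)
have same (k k' : word) d : swaps k z -> swaps k' z ->
    exists d', run (Same d) k k' = Some (Same d', [::], [::]).
  move=> cz; case: cz zm => [|a c1 z1 cz1|a b c1 z1 cz1] zm c'z.
  + by inversion c'z; exists d.
  + inversion c'z as [|? c2 ? cz2|b ? c2 z2 cz2]; subst.
      have [+ _] := IH _ c1 c2 zm; move=> /(_ d cz1 cz2)[d' E].
      by exists d'; rewrite /= eqxx.
    have [ab|ab] := eqVneq a b.
      subst b; have [/(_ d cz1 (swaps_keep a cz2))[d' E] _] := IH (a :: z2) c1 (a :: c2) zm.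
      by exists d'; rewrite /= eqxx.
    have Eb : b = ~~ a by case: a b ab {cz1 c'z zm} => -[].
    subst b; have [_ [/(_ a None isT cz1 cz2)[d' E] _]] := IH z2 c1 c2 (ltnW zm).
    by exists d'; rewrite /= (negbTE ab).
  + inversion c'z as [|? c2 ? cz2|? ? c2 z2 cz2]; subst.
      have [ab|ab] := eqVneq a b.
        subst b; have [/(_ d (swaps_keep a cz1) cz2)[d' E] _] := IH (a :: z1) (a :: c1) c2 zm.
        by exists d'; rewrite /= eqxx.
      have Eb : b = ~~ a by case: a b ab {cz1 c'z cz2 zm} => -[].
      subst b; have [_ [_ /(_ a None isT cz1 cz2)[d' E]]] := IH z1 c1 c2 (ltnW zm).
      by exists d'; move: E; rewrite /= (negbTE ab).
    have [/(_ d cz1 cz2)[d' E] _] := IH _ c1 c2 (ltnW zm).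
    by exists d'; rewrite /= eqxx /= eqxx.
split; [|split]; first exact: same.
- move=> a l la cz c'z.
  have close k : swaps k z ->
      exists d', run (Open a l) (~~ a :: k) (a :: c') = Some (Same d', [::], [::]).
    move=> kz; have [d' E] := same k c' true kz c'z; exists d'.
    by rewrite -E /=; case: (a).
  inversion cz as [|? c1 ? cz1|b ? c1 z1 cz1]; subst; first exact: close.
  have [ab|ab] := eqVneq b (~~ a); first by subst b; apply/close/swaps_keep.
  have Eb : b = a by case: a b ab {la cz c'z zm close same} => -[].
  subst b; have na : Some a != Some (~~ a) by case: (a).
  (* Reading the common symbol [a] passes the debt to the other word, so the third claim applies to
     the shorter [z1]. *)
  have [_ [_ /(_ a _ na cz1 c'z)[d' E]]] := IH z1 c1 c' zm.
  by exists d'; rewrite -E /= eqxx (negbTE la).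
- move=> a l la cz c'z.
  have close k : swaps k z ->
      exists d', run (Open a l) (~~ a :: c) (a :: k) = Some (Same d', [::], [::]).
    move=> kz; have [d' E] := same c k true cz kz; exists d'.
    by rewrite -E /=; case: (a).
  inversion c'z as [|? c1 ? cz1|b ? c1 z1 cz1]; subst; first exact: close.
  have [ab|ab] := eqVneq b a; first by subst b; apply/close/swaps_keep.
  have Eb : b = ~~ a by case: a b ab {la cz c'z zm close same} => -[].
  subst b; have na : Some (~~ a) != Some a by case: (a).
  have [_ [/(_ a _ na cz cz1)[d' E] _]] := IH z1 c c1 zm.
  by exists d'; rewrite -E /= eqxx (negbTE la).
Qed.

Lemma run_swaps (z c c' : word) d : swaps c z -> swaps c' z ->
  exists d', run (Same d) c c' = Some (Same d', [::], [::]).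
Proof.
by move=> cz c'z; have [/(_ d cz c'z)] := @run_swaps_aux (size z).+1 z c c' (ltnSn _).
Qed.

(** [Same false] is entered only from itself, on equal symbols, so whatever was read is a common
    prefix. *)
Lemma run_same (s : state) (c c' r r' : word) :
  run s c c' = Some (Same false, r, r') ->
  s = Same false /\ exists2 p, c = p ++ r & c' = p ++ r'.
Proof.
elim: c c' s => [|a c IH] [|b c'] s /=; try by case=> -> <- <-; split=> //; exists [::].
case E : (step s a b) => [s'|] // /IH[s'E [p -> ->]]; subst s'.
case: s E => [d|x l] /=; last by case: eqP => _; [case: ifP|case: ifP].
by case: eqP => // -> [->]; split=> //; exists (b :: p).
Qed.

Lemma run_cat (s : state) (u v w x : word) :
  run s (u ++ v) (w ++ x) =
  if run s u w is Some (s', r, r') then run s' (r ++ v) (r' ++ x) else None.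
Proof.
elim: u w s => [|a u IH] [|b w] s //=.
by case: (step s a b).
Qed.

(** * Dangling suffixes *)

Definition closed_under (K : seq (state * word * word))
    (o : option (state * word * word)) : bool :=
  if o is Some k then k \in K else true.

(** A Sardinas-Patterson certificate enriched with automaton states. Demanding [Same false] when
    both sides are exhausted excludes two distinct codewords with a common ball element. *)
Definition closed_danglings (P : seq word) (K : seq (state * word * word)) : bool :=
  all (fun k =>
    match k with
    | (s, [::], [::]) => (s == Same false) &&
        all (fun w => all (fun w' => closed_under K (run s w w')) P) P
    | (s, [::], r') => all (fun w => closed_under K (run s w r')) P
    | (s, r, [::]) => all (fun w' => closed_under K (run s r w')) P
    | _ => false
    end) K.

(** Induction on the number of unread words: each round feeds a word to every exhausted side, and
    closure keeps the configuration in [K]. *)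
Lemma run_closed (P : seq word) (K : seq (state * word * word)) s s' r r' ws ws' :
  closed_danglings P K -> (s, r, r') \in K ->
  {subset ws <= P} -> {subset ws' <= P} ->
  run s (r ++ flatten ws) (r' ++ flatten ws') = Some (s', [::], [::]) ->
  s' = Same false.
Proof.
move=> /allP Kcl; have [m] := ubnP (size ws + size ws').
elim: m s r r' ws ws' => // m IH s r r' ws ws' sz inK wsP ws'P.
have sub w v : {subset w :: v <= P} -> w \in P /\ {subset v <= P}.
  by move=> H; split=> [|x xv]; apply: H; rewrite inE ?eqxx ?xv ?orbT.
case: r r' inK => [|a r] [|b r'] inK; have Kr := Kcl _ inK; last by [].
- move: Kr => /andP[/eqP -> /allP PP].
  case: ws wsP sz => [|w ws] wsP sz.
    (* With no word left on one side the run stops at once, still in [Same false]. *)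
    by case: (flatten ws') => //= -[].
  case: ws' ws'P sz => [|w' ws'] ws'P sz.
    by case: (flatten (w :: ws)) => //= -[].
  have [wP {}wsP] := sub _ _ wsP; have [w'P {}ws'P] := sub _ _ ws'P.
  have /allP/(_ _ w'P) := PP _ wP.
  rewrite !cat0s [flatten (w :: _)]/= [flatten (w' :: _)]/= run_cat.
  case: (run _ _ _) => // -[[s1 r1] r1'] /= inK1.
  by apply: IH => //; move: sz => /=; lia.
- have /allP PP : all (fun w => closed_under K (run s w (b :: r'))) P := Kr.
  case: ws wsP sz => [|w ws] wsP sz; first by [].
  have [wP {}wsP] := sub _ _ wsP; have := PP _ wP.
  rewrite cat0s [flatten (w :: _)]/= run_cat.
  case: (run _ _ _) => // -[[s1 r1] r1'] /= inK1.
  by apply: IH => //; move: sz => /=; lia.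
- have /allP PP : all (fun w => closed_under K (run s (a :: r) w)) P := Kr.
  case: ws' ws'P sz => [|w ws'] ws'P sz; first by [].
  have [wP {}ws'P] := sub _ _ ws'P; have := PP _ wP.
  rewrite cat0s [flatten (w :: _)]/= run_cat.
  case: (run _ _ _) => // -[[s1 r1] r1'] /= inK1.
  by apply: IH => //; move: sz => /=; lia.
Qed.

(** A common ball element lets the run exhaust both codewords; the certificate puts its last state
    at [Same false], and then the codewords agree. *)
Lemma correcting_star_code (P : {fset word}) (K : seq (state * word * word)) n :
  closed_danglings P K -> (Same false, [::], [::]) \in K ->
  correcting (star_code P n).
Proof.
move=> Kcl K0 c c'; rewrite /star_code !finset.in_set.
move=> /asboolP[ws wsP cE] /asboolP[ws' ws'P c'E] cc'.
apply/finset.setP => z; rewrite finset.in_setI finset.in_set0.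
apply/negbTE/negP => /andP[zc zc'].
have [d E] := run_swaps false (swaps_of_ball1 zc) (swaps_of_ball1 zc').
have dE := E; rewrite cE c'E in dE.
have := @run_closed P K (Same false) (Same d) [::] [::] ws ws' Kcl K0 wsP ws'P dE.
case=> d0; rewrite d0 in E; have [_ [p cp cp']] := run_same E.
by move/eqP: cc'; apply; apply: val_inj => /=; rewrite cp cp'.
Qed.

Definition prefix_free (P : seq word) :=
  {in P &, forall w w', prefix w w' -> w = w'}.

Lemma run_prefix d w v : run (Same d) w (w ++ v) = Some (Same d, [::], v).
Proof. by elim: w => [|a w IH] /=; [case: v|rewrite eqxx]. Qed.

(** Running a prefix [w] against [w ++ v] meets no difference and leaves [v] dangling, so [v] is
    empty by the hypothesis on [K]. *)
Lemma prefix_free_closed (P : seq word) (K : seq (state * word * word)) :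
  closed_danglings P K -> (Same false, [::], [::]) \in K ->
  (forall r r', (Same false, r, r') \in K -> r' = [::]) ->
  prefix_free P.
Proof.
move=> /allP Kcl K0 Ksame w w' wP w'P /prefixP[v w'E].
have /andP[_ /allP/(_ w wP)/allP/(_ w' w'P)] := Kcl _ K0.
by rewrite /closed_under w'E run_prefix => /Ksame ->; rewrite cats0.
Qed.

(** * Counting codewords *)

Definition codewords (P : {fset word}) (n : nat) : seq word :=
  map val (enum (star_code P n)).

Lemma mem_codewords (P : {fset word}) n w :
  (w \in codewords P n) = (size w == n) && `[< star P w >].
Proof.
apply/mapP/andP => [[c + ->]|[/eqP wn wP]].
  by rewrite mem_enum /star_code finset.in_set size_tuple.
subst n; exists (in_tuple w) => //.
by rewrite mem_enum /star_code finset.in_set.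
Qed.

Lemma uniq_codewords P n : uniq (codewords P n).
Proof. by rewrite map_inj_uniq ?enum_uniq //; exact: val_inj. Qed.

Lemma size_codewords P n : size (codewords P n) = #|star_code P n|.
Proof. by rewrite size_map -cardE. Qed.

Lemma star_nil (P : {fset word}) : star P [::].
Proof. by exists [::]. Qed.

Lemma star_cat (P : {fset word}) w v : w \in P -> star P v -> star P (w ++ v).
Proof.
move=> wP [ws wsP ->]; exists (w :: ws) => // x.
by rewrite inE => /orP[/eqP ->|/wsP].
Qed.

Lemma card_star_code0 (P : {fset word}) : #|star_code P 0| = 1.
Proof.
rewrite -size_codewords -[RHS]/(size [:: [::] : word]).
apply/perm_size/uniq_perm => //; first exact: uniq_codewords.
move=> w; rewrite mem_codewords size_eq0 mem_seq1.
by apply/andP/idP => [[]|/eqP ->] //; split=> //; apply/asboolP/star_nil.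
Qed.

(** Codewords are sorted by their first word, which prefix-freeness makes unique. *)
Lemma card_star_code_rec (P : {fset word}) n :
  prefix_free P -> 0 < n -> [::] \notin P ->
  #|star_code P n| = \sum_(w <- P | size w <= n) #|star_code P (n - size w)|.
Proof.
move=> Pfree n0 nil0.
pose L := [seq w ++ v | w <- [seq w <- P | size w <= n], v <- codewords P (n - size w)].
have LE : codewords P n =i L.
  move=> c; rewrite mem_codewords; apply/andP/allpairsPdep.
    move=> [/eqP cn /asboolP[[|w ws] wsP cE]]; first by move: n0; rewrite -cn cE.
    have wP : w \in P by apply: wsP; rewrite inE eqxx.
    have szc : n = size w + size (flatten ws) by rewrite -cn cE size_cat.
    exists w, (flatten ws); rewrite mem_filter wP szc leq_addr mem_codewords addKn eqxx.
    split=> //=; apply/asboolP; exists ws => // x xs.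
    by apply: wsP; rewrite inE xs orbT.
  move=> [w [v [+ + ->]]]; rewrite mem_filter mem_codewords.
  move=> /andP[wn wP] /andP[/eqP vn /asboolP vP].
  by rewrite size_cat vn subnKC //; split=> //; apply/asboolP/star_cat.
have Lu : uniq L.
  apply: allpairs_uniq_dep; [exact/filter_uniq/fset_uniq|move=> *; exact: uniq_codewords|].
  move=> _ _ /allpairsPdep[w [v [+ _ ->]]] /allpairsPdep[w' [v' [+ _ ->]]] /= E.
  rewrite !mem_filter => /andP[_ wP] /andP[_ w'P].
  suff ww' : w = w'.
    by subst w'; move/eqP: E; rewrite eqseq_cat // eqxx => /eqP ->.
  (* Of two first words of the same codeword, the shorter is a prefix of the longer. *)
  wlog le : w w' v v' E wP w'P / size w <= size w'.
    move=> H; have [|/ltnW] := leqP (size w) (size w') => /H; first by apply; eauto.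
    by move=> H'; symmetry; apply: H'; eauto.
  apply: Pfree => //; apply/prefixP.
  exists (drop (size w) w'); rewrite -[LHS](cat_take_drop (size w)); congr (_ ++ _).
  by move/(congr1 (take (size w))): E; rewrite take_size_cat // takel_cat.
rewrite -size_codewords (perm_size (uniq_perm (uniq_codewords P n) Lu LE)).
rewrite size_allpairs_dep sumnE big_map big_filter.
by apply: eq_bigr => w _; rewrite size_codewords.
Qed.

Lemma num_of_length_count (P : {fset word}) l :
  num_of_length P l = count (fun w => size w == l) P.
Proof.
rewrite -size_filter; apply/perm_size/uniq_perm; first exact: fset_uniq.
  exact/filter_uniq/fset_uniq.
by move=> w; rewrite !inE mem_filter andbC.
Qed.

Lemma sum_by_length (P : {fset word}) a b (F : nat -> nat) :
  (forall w, w \in P -> a <= size w < b) ->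
  \sum_(w <- P) F (size w) = \sum_(a <= l < b) num_of_length P l * F l.
Proof.
move=> Psz; transitivity (\sum_(w <- P) \sum_(a <= l < b) (size w == l) * F l).
  rewrite big_seq [RHS]big_seq; apply: eq_bigr => w /Psz wab.
  rewrite (bigD1_seq (size w)) ?mem_index_iota ?iota_uniq //= eqxx mul1n.
  by rewrite big1 ?addn0 // => l; rewrite eq_sym => /negbTE ->.
rewrite exchange_big; apply: eq_bigr => l _ /=; rewrite -big_distrl /=; congr (_ * _).
rewrite num_of_length_count -sum1_count [RHS]big_mkcond.
by apply: eq_bigr => w _; case: ifP.
Qed.

(** The conditional guards against truncated subtraction: for [l > n] the index [n - l] would be 0,
    where there is one codeword. *)
Lemma card_star_code_by_length (P : {fset word}) a b n :
  prefix_free P -> 0 < a -> (forall w, w \in P -> a <= size w < b) -> 0 < n ->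
  #|star_code P n| =
    \sum_(a <= l < b) num_of_length P l * (if l <= n then #|star_code P (n - l)| else 0).
Proof.
move=> Pfree a0 Psz n0; rewrite card_star_code_rec //.
  by rewrite big_mkcond -(sum_by_length _ Psz).
by apply/negP => /Psz /=; lia.
Qed.

(** * The set Pstar *)

Definition Hstar_seq : seq word := map word_of_string Hstar_list.

(** A plain list on which the finite checks are evaluated; [perm_Pstar] transfers them to
    [Pstar]. *)
Definition Pstar_seq : seq word := Hstar_seq ++ map complement Hstar_seq.

(* The smallest closed set of configurations containing the initial one; it is
   stable under complement and under exchanging the two sides. *)
Definition danglings : seq (state * word * word) :=
  (Same false, [::], [::]) ::
  flatten [seq [:: (Open false None, s, [::]); (Open true None, [::], s);
                   (Open true None, complement s, [::]);
                   (Open false None, [::], complement s)]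
          | s <- map word_of_string [:: "00"; "000"; "001111"; "00111";
                                        "00111000"; "001110000"]%string].

(** The finite core of error correction: all ordered pairs of words from the initial configuration,
    and one further word from each of the others. *)
Lemma closed_danglings_Pstar : closed_danglings Pstar_seq danglings.
Proof. by vm_compute. Qed.

Lemma uniq_Pstar_seq : uniq Pstar_seq.
Proof. by vm_compute. Qed.

Lemma perm_Hstar : perm_eq Hstar Hstar_seq.
Proof.
apply: uniq_perm; first exact: fset_uniq.
  exact: (subseq_uniq (prefix_subseq Hstar_seq _) uniq_Pstar_seq).
exact: in_fset.
Qed.

Lemma perm_Pstar : perm_eq Pstar Pstar_seq.
Proof.
apply: uniq_perm; [exact: fset_uniq|exact: uniq_Pstar_seq|move=> w].
rewrite in_fsetU mem_cat (perm_mem perm_Hstar); congr (_ || _).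
apply/imfsetP/mapP => -[v vH ->]; exists v => //=.
  by rewrite -(perm_mem perm_Hstar).
by rewrite (perm_mem perm_Hstar).
Qed.

Lemma num_of_length_Pstar l :
  num_of_length Pstar l = count (fun w => size w == l) Pstar_seq.
Proof.
by rewrite num_of_length_count; move: perm_Pstar => /seq.permP.
Qed.

Lemma lengths_Pstar :
  [seq num_of_length Pstar l | l <- iota 10 10]
    = [:: 14; 6; 78; 58; 56; 92; 60; 72; 58; 80].
Proof. by rewrite (eq_map num_of_length_Pstar); vm_compute. Qed.

Lemma size_Pstar w : w \in Pstar -> 10 <= size w < 20.
Proof.
rewrite (perm_mem perm_Pstar); move: w; apply/allP.
by vm_compute.
Qed.

Lemma closed_danglings_eq_mem (P Q : seq word) K :
  P =i Q -> closed_danglings P K = closed_danglings Q K.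
Proof.
move=> PQ; apply: eq_all => -[[s [|a r]] [|b r']] //; rewrite ?(eq_all_r PQ) //.
by congr (_ && _); apply: eq_all => w; rewrite (eq_all_r PQ).
Qed.

Lemma closed_danglings_Pstar_fset : closed_danglings Pstar danglings.
Proof.
by rewrite (closed_danglings_eq_mem _ (perm_mem perm_Pstar)) closed_danglings_Pstar.
Qed.

Lemma prefix_free_Pstar : prefix_free Pstar.
Proof.
apply: (prefix_free_closed closed_danglings_Pstar_fset) => [|r r'].
  by rewrite inE eqxx.
(* Every configuration but the initial one has an open difference. *)
have /allP sameP : all (fun k => (k.1.1 == Same false) ==> (k.2 == [::])) danglings.
  by vm_compute.
by move=> /sameP/eqP.
Qed.

(** * Growth of the recurrence *)

Local Open Scope ring_scope.
Local Open Scope classical_set_scope.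

(** Strong induction: [lam ^+ n] solves the same recurrence by the equation for [lam], and the terms
    with [l > n] only help. *)
Lemma renewal_upper (R : realType) (p N : nat -> nat) a b (lam : R) :
  0 < lam -> (0 < a)%N -> N 0 = 1%N ->
  (forall n, (0 < n)%N ->
    N n = (\sum_(a <= l < b) p l * (if (l <= n)%N then N (n - l) else 0))%N) ->
  \sum_(a <= l < b) (p l)%:R * lam ^- l = 1 ->
  forall n, (N n)%:R <= lam ^+ n.
Proof.
move=> lam0 a0 N0 Nrec lamE n; have [m] := ubnP n; elim: m n => // m IH n nm.
have [->|n0] := posnP n; first by rewrite N0 expr0.
rewrite (Nrec _ n0) natr_sum -[leRHS]mulr1 -[X in _ <= _ * X]lamE mulr_sumr.
apply: ler_sum_nat => l /andP[al _]; rewrite natrM mulrCA ler_wpM2l ?ler0n //.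
case: leqP => ln; last by rewrite mulr_ge0 ?invr_ge0 ?exprn_ge0 ?ltW.
rewrite -exprB ?unitfE ?gt_eqF //; apply: IH; lia.
Qed.

(** The constant [lam ^+ (m + b)] covers the initial window [m <= n < m + b], where [N n] is at
    least 1. Beyond it, [n - l] stays at least [m] and the recurrence propagates the bound. *)
Lemma renewal_lower (R : realType) (p N : nat -> nat) a b m (lam : R) :
  1 <= lam -> (forall n, (m <= n)%N -> (0 < N n)%N) -> (0 < m)%N ->
  (forall n, (0 < n)%N ->
    N n = (\sum_(a <= l < b) p l * (if (l <= n)%N then N (n - l) else 0))%N) ->
  (0 < a)%N -> \sum_(a <= l < b) (p l)%:R * lam ^- l = 1 ->
  forall n, (m <= n)%N -> lam ^+ n <= lam ^+ (m + b) * (N n)%:R.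
Proof.
move=> lam1 Npos m0 Nrec a0 lamE n; have lam0 : 0 < lam by lra.
have [k] := ubnP n; elim: k n => // k IH n nk mn.
have [nmb|mbn] := ltnP n (m + b).
  apply: (@le_trans _ _ (lam ^+ (m + b))); first by rewrite ler_weXn2l // ltnW.
  by rewrite ler_peMr ?ler1n ?Npos ?exprn_ge0 // ltW.
rewrite (Nrec n) ?(leq_trans m0) // natr_sum -[leLHS]mulr1 -[X in _ * X <= _]lamE !mulr_sumr.
apply: ler_sum_nat => l /andP[al lb].
have ln : (l <= n)%N by lia.
rewrite ln natrM mulrCA [leRHS]mulrCA ler_wpM2l ?ler0n //.
rewrite -exprB ?unitfE ?gt_eqF //; apply: IH; lia.
Qed.

Lemma bounded_littleo (R : realType) (D : set nat) (e : nat -> R) (C : R) m :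
  (forall n, (m <= n)%N -> `|e n| <= C) ->
  e =o_ (within D \oo) (fun n : nat => n%:R : R).
Proof.
move=> eC; apply/eqoP => eps eps0.
rewrite near_withinE; near=> n; move=> _.
apply: (le_trans (eC n _)); first by near: n; exact: nbhs_infty_ge.
rewrite ger0_norm // -ler_pdivrMl //.
by near: n; exact: nbhs_infty_ger.
Unshelve. all: by end_near. Qed.

Section rate.
Variables (R : realType) (C : forall n, {set n.-tuple bool}) (lam : R) (m k : nat).
Hypothesis lam1 : 1 < lam.
Hypothesis upper : forall n, (#|C n|%:R : R) <= lam ^+ n.
Hypothesis lower : forall n, (m <= n)%N -> lam ^+ n <= lam ^+ k * #|C n|%:R.

Let lam0 : 0 < lam. Proof. exact: lt_trans ltr01 lam1. Qed.
Let lnlam0 : 0 < ln lam. Proof. exact: ln_gt0. Qed.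

Let card_pos n : (m <= n)%N -> 0 < #|C n|%:R :> R.
Proof.
move=> /lower; have := exprn_gt0 n lam0; have := exprn_gt0 k lam0.
by move=> a0 b0 ab; rewrite -(pmulr_rgt0 _ a0); exact: lt_le_trans ab.
Qed.

(** The [o(n)] term of the exponent; the two hypotheses on the sizes even make it bounded. *)
Definition exponent_error (n : nat) : R := ln #|C n|%:R / ln lam - n%:R.

Lemma exponent_error_bound n : (m <= n)%N -> `|exponent_error n| <= k%:R.
Proof.
move=> mn; have N0 := card_pos mn.
have lnX j : ln (lam ^+ j) = j%:R * ln lam by rewrite lnXn // mulr_natl.
have U : ln #|C n|%:R <= n%:R * ln lam by rewrite -lnX ler_ln ?posrE ?exprn_gt0.
have L : n%:R * ln lam <= k%:R * ln lam + ln #|C n|%:R.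
  by rewrite -!lnX -lnM ?posrE ?exprn_gt0 // ler_ln ?posrE ?mulr_gt0 ?exprn_gt0 ?lower.
have A : n%:R - k%:R <= ln #|C n|%:R / ln lam.
  by rewrite ler_pdivlMr // mulrBl lerBlDl.
have B : ln #|C n|%:R / ln lam <= n%:R by rewrite ler_pdivrMr.
rewrite /exponent_error ler_norml; apply/andP; split; first by lra.
by have := ler0n R k; lra.
Qed.

Lemma exponent_error_eq n : lengths C n ->
  #|C n|%:R = lam `^ (n%:R + exponent_error n).
Proof.
move=> Cn; have N0 : 0 < #|C n|%:R :> R by rewrite ltr0n card_gt0.
by rewrite /powR gt_eqF // /exponent_error addrC subrK divfK ?gt_eqF // lnK.
Qed.

Lemma infinite_lengths : infinite_set (lengths C).
Proof.
move=> /finite_seqP[s sE].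
(* Past [m], hence a nonempty length, yet beyond every entry of the supposed enumeration [s]. *)
pose j := maxn m (\max_(i <- s) i).+1.
have : lengths C j.
  have := card_pos (leq_maxl m (\max_(i <- s) i).+1).
  by rewrite ltr0n card_gt0.
rewrite sE /= => js; have := @leq_bigmax_seq _ s xpredT id j js isT.
by rewrite leqNgt => /negP; apply; exact: leq_maxr.
Qed.

Lemma asymptotic_rate : has_asymptotic_rate C (log2 lam).
Proof.
split; first exact: infinite_lengths.
apply/cvgrPdist_le => eps eps0; rewrite near_withinE; near=> n; move=> _.
have mn : (m <= n)%N by near: n; exact: nbhs_infty_ge.
have n0 : 0 < n%:R :> R by near: n; exact: nbhs_infty_gtr.
have ln20 : 0 < ln 2 :> R by rewrite ln_gt0 // ltr1n.
have -> : log2 lam - log2 #|C n|%:R / n%:R =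
    - (exponent_error n * log2 lam / n%:R).
  by rewrite /log2 /exponent_error; field; rewrite !gt_eqF.
have l0 : 0 <= log2 lam by rewrite divr_ge0 // ltW.
have ni0 : 0 < n%:R^-1 :> R by rewrite invr_gt0.
rewrite normrN 2!normrM (ger0_norm l0) (gtr0_norm ni0).
rewrite ler_pdivrMr // -ler_pdivrMl //.
apply: (@le_trans _ _ (eps^-1 * (k%:R * log2 lam))).
  by rewrite ler_pM2l ?invr_gt0 // ler_wpM2r // exponent_error_bound.
by near: n; exact: nbhs_infty_ger.
Unshelve. all: by end_near. Qed.

End rate.

(** * Numerical value of the rate *)

(* The first [k] binary digits of the logarithm in base 2 of [a / D], for
   [D <= a < 2 * D], by repeated squaring and rounding down. *)
Fixpoint log2_digits (D : N) (k : nat) (a : N) : N :=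
  if k is k'.+1 then
    let b := N.div (N.mul a a) D in
    if N.leb (N.mul 2 D) b
    then N.add (N.pow 2 (N.of_nat k')) (log2_digits D k' (N.div b 2))
    else log2_digits D k' b
  else 0%num.

Section N_to_R.
Variable R : realType.

Definition N2R (n : N) : R := (N.to_nat n)%:R.

Lemma N2RD m n : N2R (N.add m n) = N2R m + N2R n.
Proof. by rewrite /N2R N2Nat.inj_add plusE natrD. Qed.

Lemma N2RM m n : N2R (N.mul m n) = N2R m * N2R n.
Proof. by rewrite /N2R N2Nat.inj_mul multE natrM. Qed.

Lemma N2RX m k : N2R (N.pow m (N.of_nat k)) = N2R m ^+ k.
Proof.
elim: k => [|k IH]; first by rewrite expr0.
by rewrite Nat2N.inj_succ N.pow_succ_r' N2RM IH exprS.
Qed.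

Lemma N2R_le m n : N.le m n -> N2R m <= N2R n.
Proof. by move=> mn; rewrite ler_nat; lia. Qed.

Lemma N2R_lt m n : N.lt m n -> N2R m < N2R n.
Proof. by move=> mn; rewrite ltr_nat; lia. Qed.

Lemma N2R_gt0 n : N.lt 0 n -> 0 < N2R n.
Proof. exact: N2R_lt. Qed.

Lemma N2R2 : N2R 2 = 2. Proof. by []. Qed.

(** Squaring doubles the logarithm, halving subtracts the digit just recorded, and rounding down
    only lowers the result. *)
Lemma log2_digits_le (D : N) k a : N.lt 0 D -> N.le D a ->
  N2R (log2_digits D k a) * ln 2 <= 2 ^+ k * ln (N2R a / N2R D).
Proof.
move=> D0; elim: k a => [|k IH] a Da /=.
  rewrite expr0 mul1r mul0r ln_ge0 // ler_pdivlMr ?mul1r ?N2R_le //.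
  exact: (N2R_gt0 D0).
have D0' : 0 < N2R D := N2R_gt0 D0.
have a0' : 0 < N2R a by apply: N2R_gt0; lia.
set b := N.div (N.mul a a) D.
have bD : N2R b / N2R D <= (N2R a / N2R D) ^+ 2.
  rewrite expr_div_n ler_pdivlMr ?exprn_gt0 // exprS expr1 mulrA divfK ?gt_eqF //.
  by rewrite mulrC -N2RM expr2 -N2RM; apply: N2R_le; exact: N.Div0.mul_div_le.
have Db : N.le D b by apply: N.div_le_lower_bound; [lia|nia].
have b0 : 0 < N2R b by apply: N2R_gt0; lia.
have lnb : 2 ^+ k * ln (N2R b / N2R D) <= 2 ^+ k.+1 * ln (N2R a / N2R D).
  rewrite exprSr -mulrA ler_pM2l ?exprn_gt0 // mulr_natl -lnXn ?divr_gt0 //.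
  by rewrite ler_ln ?posrE ?exprn_gt0 ?divr_gt0.
apply: le_trans lnb; case: N.leb_spec => cb; last exact: IH.
set c := N.div b 2.
have Dc : N.le D c by exact: N.div_le_lower_bound.
have c0 : 0 < N2R c by apply: N2R_gt0; lia.
rewrite N2RD N2RX N2R2 mulrDl.
have := IH _ Dc; rewrite -/c; set t := _ * ln 2 => H.
apply: (@le_trans _ _ (2 ^+ k * (ln 2 + ln (N2R c / N2R D)))).
  by rewrite mulrDr lerD2l.
rewrite ler_pM2l ?exprn_gt0 // -lnM ?posrE ?divr_gt0 //.
have cD : 0 < N2R c / N2R D by rewrite divr_gt0.
rewrite ler_ln ?posrE ?(mulr_gt0 _ cD) ?(divr_gt0 b0 D0') ?ltr0n //.
rewrite mulrA ler_pM2r ?invr_gt0 //.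
by rewrite -N2R2 -N2RM; apply: N2R_le; exact: N.Div0.mul_div_le.
Qed.

End N_to_R.

(** * The equation for the growth rate and its positive root *)

Lemma num_of_length_nth l : (10 <= l < 20)%N ->
  num_of_length Pstar l = nth 0%N [:: 14; 6; 78; 58; 56; 92; 60; 72; 58; 80]%N (l - 10).
Proof.
move=> l20; rewrite -lengths_Pstar (nth_map 0%N) ?size_iota ?nth_iota; [|lia..].
by rewrite subnKC; [|lia].
Qed.

Lemma big_10_20 (R : realType) (F : nat -> R) :
  \sum_(10 <= l < 20) (num_of_length Pstar l)%:R * F l =
  14 * F 10%N + 6 * F 11%N + 78 * F 12%N + 58 * F 13%N + 56 * F 14%N +
  92 * F 15%N + 60 * F 16%N + 72 * F 17%N + 58 * F 18%N + 80 * F 19%N.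
Proof.
rewrite (eq_big_nat _ _ (F2 := fun l =>
    (nth 0%N [:: 14; 6; 78; 58; 56; 92; 60; 72; 58; 80]%N (l - 10))%:R * F l)).
  by rewrite /index_iota /= !big_cons big_nil addr0 !addrA.
by move=> l /num_of_length_nth ->.
Qed.

(* [v ^ 19] times the value of [length_sum] at [u / v]. *)
Definition length_form (u v : N) : N :=
  let m c k := N.mul c (N.mul (N.pow u (N.of_nat k)) (N.pow v (N.of_nat (19 - k)))) in
  (m 14 10 + m 6 11 + m 78 12 + m 58 13 + m 56 14
   + m 92 15 + m 60 16 + m 72 17 + m 58 18 + m 80 19)%num.

(** The left side of the equation in the variable [y = lam^-1], where it is a polynomial. *)
Definition length_sum (R : realType) (y : R) : R :=
  \sum_(10 <= l < 20) (num_of_length Pstar l)%:R * y ^+ l.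

Lemma length_sum_ratio (R : realType) u v : 0 < N2R R v ->
  length_sum (N2R R u / N2R R v) * N2R R v ^+ 19 = N2R R (length_form u v).
Proof.
move=> v0; rewrite /length_sum mulr_suml.
rewrite (eq_big_nat _ _ (F2 := fun l => (num_of_length Pstar l)%:R *
   (N2R R u ^+ l * N2R R v ^+ (19 - l)))); last first.
  move=> l /andP[_ l20]; rewrite -mulrA expr_div_n; congr (_ * _).
  rewrite -mulrA; congr (_ * _); rewrite -{1}(subnKC (_ : l <= 19)%N) //.
  by rewrite exprD mulKf // expf_neq0 ?gt_eqF.
rewrite big_10_20 /length_form !N2RD.
by do 9 ?[congr (_ + _)]; rewrite !N2RM !N2RX.
Qed.

Lemma length_sum_ltr (R : realType) (x y : R) : 0 <= x -> x < y ->
  length_sum x < length_sum y.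
Proof.
move=> x0 xy; rewrite /length_sum !big_10_20.
have H k c : (0 < k)%N -> 0 < c -> c * x ^+ k < c * y ^+ k.
  by move=> k0 c0; rewrite ltr_pM2l // ltrXn2r // -lt0n.
by rewrite !ltrD ?H ?ltr0n.
Qed.

Lemma length_sum_root (R : realType) (x y : R) : x <= y ->
  length_sum x <= 1 -> 1 <= length_sum y ->
  exists2 z, x <= z <= y & length_sum z = 1.
Proof.
move=> xy xl yl.
pose q : {poly R} := \sum_(10 <= l < 20) (num_of_length Pstar l)%:R *: 'X^l - 1.
have qE z : q.[z] = length_sum z - 1.
  rewrite /q !hornerE horner_sum; congr (_ - _).
  by apply: eq_bigr => l _; rewrite hornerZ hornerXn.
have [|z zxy /rootP] := @poly_ivt R q x y xy.
  by rewrite !qE; lra.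
by rewrite qE => zE; exists z => //; lra.
Qed.

(** The root [lam^-1] is caught between [b / (2 * D)] and [D / a], with denominators cleared for
    computation. Bounding [lam] by 2 over [b / D] lets lower bounds on both logarithms bracket that
    of [lam]. *)
Lemma length_sum_inverse_root (R : realType) (a b D : N) :
  N.lt 0 a -> N.lt 0 b -> N.lt 0 D ->
  N.le (N.mul a b) (N.mul D (N.mul 2 D)) ->
  N.le (N.pow a (N.of_nat 19)) (length_form D a) ->
  N.le (length_form b (N.mul 2 D)) (N.pow (N.mul 2 D) (N.of_nat 19)) ->
  exists lam : R, [/\ N2R R a / N2R R D <= lam, lam <= 2 / (N2R R b / N2R R D) &
    length_sum lam^-1 = 1].
Proof.
move=> a0 b0 D0 abD lower upper.
have D20 : 0 < N2R R (N.mul 2 D) by apply: N2R_gt0; lia.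
have {}a0 := N2R_gt0 R a0; have {}b0 := N2R_gt0 R b0; have {}D0 := N2R_gt0 R D0.
have [||| z /andP[bz za] zE] :=
    @length_sum_root R (N2R R b / N2R R (N.mul 2 D)) (N2R R D / N2R R a).
- rewrite ler_pdivrMr // mulrAC ler_pdivlMr // mulrC -!N2RM.
  exact: N2R_le.
- by rewrite -(ler_pM2r (exprn_gt0 19 D20)) length_sum_ratio // mul1r -N2RX N2R_le.
- by rewrite -(ler_pM2r (exprn_gt0 19 a0)) length_sum_ratio // mul1r -N2RX N2R_le.
have z0 : 0 < z by apply: lt_le_trans bz; rewrite divr_gt0.
exists z^-1; split; last by rewrite invrK.
- by rewrite -[leLHS]invrK invf_div lef_pV2 ?posrE ?divr_gt0.
- have -> : 2 / (N2R R b / N2R R D) = (N2R R b / N2R R (N.mul 2 D))^-1.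
    by rewrite N2RM N2R2; field; rewrite !gt_eqF.
  by rewrite lef_pV2 ?posrE ?divr_gt0.
Qed.

(** The digits give 0.653617 below and 1 - 0.346381 = 0.653619 above. Splitting constants by powers
    of 1000 keeps the numerals of [R] small. *)
Lemma log2_bracket (R : realType) (a b D : N) (lam : R) :
  N.lt 0 D -> N.le D a -> N.le D b ->
  N.lt (N.mul (N.add (N.mul 653 1000) 617) (N.pow 2 (N.of_nat 24)))
       (N.mul (log2_digits D 24 a) (N.mul 1000 1000)) ->
  N.lt (N.mul (N.add (N.mul 346 1000) 381) (N.pow 2 (N.of_nat 24)))
       (N.mul (log2_digits D 24 b) (N.mul 1000 1000)) ->
  N2R R a / N2R R D <= lam -> lam <= 2 / (N2R R b / N2R R D) ->
  `|log2 lam - (653 / 10 ^+ 3 + 618 / 10 ^+ 6)| < 10 ^- 6.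
Proof.
move=> D0 Da Db ha hb alam lamb.
have a0 : 0 < N2R R a by apply: N2R_gt0; lia.
have b0 : 0 < N2R R b by apply: N2R_gt0; lia.
have D0' := N2R_gt0 R D0.
have aD : 0 < N2R R a / N2R R D by rewrite divr_gt0.
have bD : 0 < N2R R b / N2R R D by rewrite divr_gt0.
have lam0 : 0 < lam by apply: lt_le_trans alam.
have ln2 : 0 < ln 2 :> R by rewrite ln_gt0 // ltr1n.
have A : N2R R (log2_digits D 24 a) * ln 2 <= 2 ^+ 24 * ln lam.
  apply: (le_trans (log2_digits_le R 24 D0 Da)).
  by rewrite ler_pM2l ?exprn_gt0 // ler_ln ?posrE.
have B : N2R R (log2_digits D 24 b) * ln 2 <= 2 ^+ 24 * (ln 2 - ln lam).
  apply: (le_trans (log2_digits_le R 24 D0 Db)).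
  rewrite ler_pM2l ?exprn_gt0 // lerBrDr -lnM ?posrE //.
  by rewrite ler_ln ?posrE ?(mulr_gt0 bD lam0) // mulrC -ler_pdivlMr.
pose T : R := 10 ^+ 3; pose P : R := 2 ^+ 24; pose x := log2 lam.
have T0 : 0 < T by rewrite exprn_gt0.
have P0 : 0 < P by rewrite exprn_gt0.
have T1000 : T = 1000%:R by rewrite /T -natrX.
have A' : (653 * T + 617) * P < N2R R (log2_digits D 24 a) * (T * T).
  by rewrite T1000; have := N2R_lt R ha; rewrite !N2RM !N2RD !N2RM N2RX.
have B' : (346 * T + 381) * P < N2R R (log2_digits D 24 b) * (T * T).
  by rewrite T1000; have := N2R_lt R hb; rewrite !N2RM !N2RD !N2RM N2RX.
have xE : ln lam = x * ln 2 by rewrite /x /log2 divfK ?gt_eqF.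
have {}A : N2R R (log2_digits D 24 a) <= P * x.
  by rewrite -(ler_pM2r ln2) -mulrA -xE.
have {}B : N2R R (log2_digits D 24 b) <= P * (1 - x).
  by rewrite -(ler_pM2r ln2) -mulrA mulrBl mul1r -xE.
have T2 : 0 < T * T by rewrite mulr_gt0.
have {A A'} : 653 * T + 617 < x * (T * T).
  rewrite -(ltr_pM2r P0); apply: lt_le_trans A' _.
  by rewrite [leRHS]mulrAC ler_pM2r // [x * P]mulrC.
have {B B'} : 346 * T + 381 < (1 - x) * (T * T).
  rewrite -(ltr_pM2r P0); apply: lt_le_trans B' _.
  by rewrite [leRHS]mulrAC ler_pM2r // [(1 - x) * P]mulrC.
have -> : log2 lam - (653 / 10 ^+ 3 + 618 / 10 ^+ 6) =
    (x * (T * T) - 653 * T - 618) / (T * T).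
  by rewrite -/x (exprM 10 3 2) -/T; field; exact: lt0r_neq0.
rewrite normrM normfV (gtr0_norm T2) ltr_pdivrMr //.
rewrite (exprM 10 3 2) -/T -expr2 mulVf ?lt0r_neq0 ?expr2 //.
have T2E : T * T = 1000%:R * T by rewrite {1}T1000.
rewrite mulrBl mul1r ltr_norml => B A; apply/andP; split; first by lra.
by move: B; rewrite [X in _ < X - _]T2E; lra.
Qed.

Lemma growth_rate_exists (R : realType) : exists lam : R,
  [/\ 1 < lam, length_sum lam^-1 = 1 &
      `|log2 lam - (653 / 10 ^+ 3 + 618 / 10 ^+ 6)| < 10 ^- 6].
Proof.
(* [a / D] and [2 * D / b] enclose the root within 2e-8. The large scale [D] absorbs rounding
   errors, which each of the 24 squarings doubles. *)
pose a : N := 1573108380000000; pose b : N := 1271368210000000.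
pose D : N := 1000000000000000.
have [||||||lam [alam lamb lamE]] := @length_sum_inverse_root R a b D.
- by apply/N.ltb_spec0; vm_compute.
- by apply/N.ltb_spec0; vm_compute.
- by apply/N.ltb_spec0; vm_compute.
- by apply/N.leb_spec0; vm_compute.
- by apply/N.leb_spec0; vm_compute.
- by apply/N.leb_spec0; vm_compute.
exists lam; split; last 1 first.
- apply: log2_bracket alam lamb.
  + by apply/N.ltb_spec0; vm_compute.
  + by apply/N.leb_spec0; vm_compute.
  + by apply/N.leb_spec0; vm_compute.
  + by apply/N.ltb_spec0; vm_compute.
  + by apply/N.ltb_spec0; vm_compute.
- apply: lt_le_trans alam; rewrite ltr_pdivlMr ?mul1r.
    by apply: N2R_lt; apply/N.ltb_spec0; vm_compute.
  by apply: N2R_gt0; apply/N.ltb_spec0; vm_compute.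
- exact: lamE.
Qed.

(** * Nonempty lengths and assembly of the theorem *)

Lemma star_code_gt0 (P : {fset word}) u v q r : u \in P -> v \in P ->
  (0 < #|star_code P (q * size u + r * size v)|)%N.
Proof.
move=> uP vP; pose ws := nseq q u ++ nseq r v.
have szw : size (flatten ws) = (q * size u + r * size v)%N.
  by rewrite flatten_cat size_cat !size_flatten /shape !map_nseq !sumn_nseq !(mulnC (size _)).
rewrite -szw card_gt0; apply/finset.set0Pn; exists (in_tuple (flatten ws)).
rewrite /star_code finset.in_set; apply/asboolP; exists ws => // w.
by rewrite mem_cat => /orP[] /nseqP[->].
Qed.

Lemma star_code_Pstar_gt0 n : (90 <= n)%N -> (0 < #|star_code Pstar n|)%N.
Proof.
(* Entries 0 and 7 are the first words of lengths 10 and 11. *)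
move=> n90; pose u := nth [::] Pstar_seq 0; pose v := nth [::] Pstar_seq 7.
have uP : u \in Pstar by rewrite (perm_mem perm_Pstar) mem_nth.
have vP : v \in Pstar by rewrite (perm_mem perm_Pstar) mem_nth.
(* The subtraction is not truncated: [n >= 90] makes the quotient at least 9, and the remainder is
   at most 9. *)
have nE : n = ((n %/ 10 - n %% 10) * 10 + n %% 10 * 11)%N.
  by have := divn_eq n 10; have := @ltn_pmod n 10 isT; lia.
have su : size u = 10%N by vm_compute.
have sv : size v = 11%N by vm_compute.
have := star_code_gt0 (n %/ 10 - n %% 10) (n %% 10) uP vP.
by rewrite su sv -nE.
Qed.

Unset Implicit Arguments.

Theorem mainTheorem3 (R : realType) :
  #|` Hstar|%fset = 287%N /\
  #|` Pstar|%fset = 574%N /\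
  [seq num_of_length Pstar l | l <- iota 10 10]
    = [:: 14; 6; 78; 58; 56; 92; 60; 72; 58; 80]%N /\
  (forall l : nat, ~~ (10 <= l <= 19)%N -> num_of_length Pstar l = 0%N) /\
  (forall n : nat, correcting (star_code Pstar n)) /\
  exists lambda : R,
    unique (fun x : R => 0 < x /\
      \sum_(10 <= l < 20) (num_of_length Pstar l)%:R * x ^- l = 1) lambda /\
    (exists e : nat -> R,
      e =o_ (within (lengths (star_code Pstar)) \oo) (fun n : nat => n%:R : R) /\
      forall n : nat, lengths (star_code Pstar) n ->
        #|star_code Pstar n|%:R = lambda `^ (n%:R + e n)) /\
    has_asymptotic_rate (star_code Pstar) (log2 lambda) /\
    `|log2 lambda - (653 / 10 ^+ 3 + 618 / 10 ^+ 6)| < 10 ^- 6.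
Proof.
split; first by rewrite (perm_size perm_Hstar); vm_compute.
split; first by rewrite (perm_size perm_Pstar); vm_compute.
split; first exact: lengths_Pstar.
split.
  move=> l l1019; rewrite num_of_length_count; apply/eqP; rewrite -leqn0 leqNgt -has_count.
  by apply/negP => /hasP[w /size_Pstar wP /eqP wl]; move: wP l1019; rewrite wl ltnS => ->.
split.
  move=> n; apply: (correcting_star_code closed_danglings_Pstar_fset).
  by rewrite inE eqxx.
have [lam [lam1 lamE lam_log]] := growth_rate_exists R.
have sumE (x : R) : \sum_(10 <= l < 20) (num_of_length Pstar l)%:R * x ^- l =
    length_sum x^-1.
  by apply: eq_bigr => l _; rewrite exprVn.
have lam0 : 0 < lam by apply: lt_trans lam1.
have lamsum : \sum_(10 <= l < 20) (num_of_length Pstar l)%:R * lam ^- l = 1.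
  by rewrite sumE.
have Nrec n := @card_star_code_by_length Pstar 10 20 n prefix_free_Pstar isT size_Pstar.
pose N n := #|star_code Pstar n|.
have upper := @renewal_upper R _ N 10 20 _ lam0 isT (card_star_code0 Pstar) Nrec lamsum.
have lower := @renewal_lower R _ N 10 20 90 _ (ltW lam1) star_code_Pstar_gt0 isT Nrec isT lamsum.
exists lam; split.
  split=> // x [x0]; rewrite sumE => xE.
  have xi0 : 0 <= x^-1 by rewrite invr_ge0 ltW.
  have lami0 : 0 <= lam^-1 by rewrite invr_ge0 ltW.
  (* Uniqueness: [length_sum] is strictly increasing on nonnegative reals, so it takes the value 1
     only once there. *)
  apply: invr_inj; have [xl|xl|//] := ltgtP x^-1 lam^-1.
    by have := length_sum_ltr xi0 xl; lra.
  by have := length_sum_ltr lami0 xl; lra.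
split.
  exists (exponent_error (star_code Pstar) lam); split.
    exact: (bounded_littleo _ (exponent_error_bound lam1 upper lower)).
  exact: exponent_error_eq.
split; first exact: asymptotic_rate upper lower.
exact: lam_log.
Qed.
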